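(* Let $(\Omega,\Sigma,\mu)$ be a weakly localizable measure space. Let $\mathcal{H}$ be a family of measurable functions $h:\Omega\to[0,+\infty]$ such that $\{h>0\}\in\mathcal{F}_\mu$ for every $h\in\mathcal{H}$. Then there exists a measurable function $g_{\mathcal{H}}:\Omega\to[0,+\infty]$ such that (a) for every $h\in\mathcal{H}$, $\{h>g_{\mathcal{H}}\}\in\mathcal{N}_\mu$; (b) if $F\in\Sigma$ and $u:\Omega\to[0,\infty]$ is a measurable function such that $F\cap\{h>u\}\in\mathcal{N}_\mu$ for every $h\in\mathcal{H}$, then $F\cap\{g_{\mathcal{H}}>u\}\in\mathcal{N}_\mu$.
   Context: A measure on a measurable space $(\Omega,\Sigma)$ ($\Sigma$ a $\sigma$-algebra on the set $\Omega$) is a $\sigma$-additive function $\mu:\Sigma\to[0,+\infty]$ with $\mu(\emptyset)=0$. Put $\mathcal{N}_\mu=\{A\in\Sigma:\mu(A)=0\}$ and $\mathcal{F}_\mu=\{A\in\Sigma:\mu(A)<+\infty\}$. A function $f:\Omega\to[-\infty,\infty]$ is measurable if $\{f>t\}=\{x\in\Omega:f(x)>t\}\in\Sigma$ for every $t\in\mathbb{R}$. For functions $f,k$, $\{f>k\}=\{x\in\Omega:f(x)>k(x)\}$. $\mu$-supremum: a set $A\in\Sigma$ is a $\mu$-supremum of a family $\mathcal{E}\subseteq\Sigma$ if (1) for every $E\in\mathcal{E}$, $E\setminus A\in\mathcal{N}_\mu$; and (2) whenever $B\in\Sigma$ is such that $B\cap E\in\mathcal{N}_\mu$ for every $E\in\mathcal{E}$,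 then $B\cap A\in\mathcal{N}_\mu$. $(\Omega,\Sigma,\mu)$ is weakly localizable if every family $\mathcal{E}\subseteq\mathcal{F}_\mu$ has a $\mu$-supremum. *)

(* Defs.v *)
From HB Require Import structures.
From mathcomp Require Import all_boot all_order all_algebra.
From mathcomp Require Import all_classical all_reals all_analysis.
From mathcomp Require Import measurable_realfun.

Set Implicit Arguments.
Unset Strict Implicit.
Unset Printing Implicit Defensive.

Import Order.TTheory GRing.Theory Num.Theory.
Import numFieldNormedType.Exports.

Local Open Scope classical_set_scope.
Local Open Scope ring_scope.
Local Open Scope ereal_scope.

(* Unlike the library's [negligible], null sets are required to be measurable. *)
Definition null_sets (d : measure_display) (T : measurableType d)
    (R : realType) (mu : set T -> \bar R) : set (set T) :=
  [set A | measurable A /\ mu A = 0].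

Definition finite_sets (d : measure_display) (T : measurableType d)
    (R : realType) (mu : set T -> \bar R) : set (set T) :=
  [set A | measurable A /\ mu A < +oo].

Definition mu_supremum (d : measure_display) (T : measurableType d)
    (R : realType) (mu : set T -> \bar R) (EE : set (set T)) (A : set T) : Prop :=
  [/\ measurable A,
      forall E, EE E -> null_sets mu (E `\` A)
    & forall B, measurable B ->
        (forall E, EE E -> null_sets mu (B `&` E)) -> null_sets mu (B `&` A)].

Definition weakly_localizable (d : measure_display) (T : measurableType d)
    (R : realType) (mu : set T -> \bar R) : Prop :=
  forall EE : set (set T), EE `<=` finite_sets mu ->
    exists A : set T, mu_supremum mu EE A.

(* [{f > k}] *)
Definition set_gt (T : Type) (R : realType) (f k : T -> \bar R) : set T :=
  [set x | k x < f x].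

(* Borel measurability of an extended-real function amounts to measurability
   of its strict superlevel sets at real levels. *)
Lemma emeasurable_fun_gtP (d : measure_display) (T : measurableType d)
    (R : realType) (f : T -> \bar R) :
  measurable_fun setT f <->
  forall t : R, measurable (set_gt f (cst t%:E)).
Proof.
split=> [mf t|mf].
  by rewrite -[set_gt _ _]setTI; exact: emeasurable_fun_o_infty.
apply: (measurability _ (ErealGenOInfty.measurableE R)) => //.
move=> _ [_ [t ->] <-]; rewrite setTI.
suff -> : f @^-1` `]t%:E, +oo[ = set_gt f (cst t%:E) by exact: mf.
by apply/seteqP; split => x; rewrite /set_gt /= in_itv /= andbT.
Qed.

(* Main.v *)
Require Import Defs.
From HB Require Import structures.
From mathcomp Require Import all_boot all_order all_algebra.
From mathcomp Require Import all_classical all_reals all_analysis.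
From mathcomp Require Import measurable_realfun.

Set Implicit Arguments.
Unset Strict Implicit.
Unset Printing Implicit Defensive.

Import Order.TTheory GRing.Theory Num.Theory.
Import numFieldNormedType.Exports.

Local Open Scope classical_set_scope.
Local Open Scope ring_scope.
Local Open Scope ereal_scope.

(** The function g is rebuilt from its superlevel sets.  A family of sets has an
    essential supremum by weak localizability, so for each level c the sets
    {h > c}, h in H, have one, A_c; morally A_c is {g > c}.  Uncountably many
    levels would accumulate uncontrolled null sets, so only countably many are
    used: the rationals [q], through the nonnegative level c = |q| (finiteness
    of the measure of {h > 0} passes to {h > c} because c >= 0).  Then g is the
    pointwise supremum of the step functions c 1_{A_c}.

    Both properties reduce to countable unions, because nonnegative rationals
    are dense in [0, +oo].  If g x < h x, some level c lies in between, and then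
    x is in {h > c} but not in A_c: so {h > g} is covered by the null sets
    {h > c} \ A_c.  If u x < g x, then u x < c for some c with x in A_c: so
    F `&` {g > u} is covered by the sets F `&` {u < c} `&` A_c, each of which is
    null by the minimality of A_c, since F `&` {u < c} meets each {h > c}
    inside the null set F `&` {h > u}. *)

(** Null sets here are measurable, so a subset of a countable union of null sets
    has to be known measurable to be null. *)
Lemma null_sets_sub_bigcup (R : realType) (d : measure_display)
    (T : measurableType d) (mu : {measure set T -> \bar R})
    (I : countType) (N : I -> set T) (A : set T) :
  measurable A -> (forall i, null_sets mu (N i)) -> A `<=` \bigcup_i N i ->
  null_sets mu A.
Proof.
move=> mA N0 AN; split=> //; apply/negligibleP => //.
(* Reindex by nat along the partial inverse of the encoding of I. *)
apply: (@negligibleS _ _ _ _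
    (\bigcup_n if unpickle n is Some i then N i else set0)).
  by move=> x /AN[i _ Nix]; exists (pickle i) => //; rewrite pickleK.
apply: negligible_bigcup => n; case: unpickle => [i|].
  by have [mN muN] := N0 i; exact/negligibleP.
exact: negligible_set0.
Qed.

Lemma null_sets_sub (R : realType) (d : measure_display)
    (T : measurableType d) (mu : {measure set T -> \bar R}) (A B : set T) :
  measurable A -> null_sets mu B -> A `<=` B -> null_sets mu A.
Proof.
move=> mA B0 AB; apply: (@null_sets_sub_bigcup _ _ _ _ unit (cst B)) => //.
by move=> x /AB; exists tt.
Qed.

Lemma measurable_set_gt (R : realType) (d : measure_display)
    (T : measurableType d) (f k : T -> \bar R) :
  measurable_fun setT f -> measurable_fun setT k -> measurable (set_gt f k).
Proof.
by move=> mf mk; rewrite -[set_gt _ _]setTI; exact: measurable_lte.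
Qed.

Lemma rat_dense_ge0_ereal (R : realType) (a b : \bar R) :
  0 <= a -> a < b -> exists q : rat, a < `|ratr q|%:E < b.
Proof.
case: a => [a| |] // a0; last by rewrite ltNge leey.
have dense (c : R) : (a < c)%R -> exists q : rat, (a < `|ratr q| < c)%R.
  move=> /rat_in_itvoo[q]; rewrite in_itv /= => /andP[aq qc]; exists q.
  by rewrite ger0_norm ?aq // ltW // (le_lt_trans _ aq).
case: b => [b| |] // ab; first by have [q] := dense _ ab; exists q.
have [q /andP[aq _]] := dense (a + 1)%R ltac:(by rewrite ltrDl).
by exists q; rewrite lte_fin aq ltry.
Qed.

(** Recovers a function from superlevel sets: if f >= 0, the levels [c i] are
    dense in [0, +oo[ and [A i] is {f > c i}, then this supremum is f. *)
Definition level_sup (R : realType) (T I : Type) (c : I -> R) (A : I -> set T)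
    (x : T) : \bar R :=
  ereal_sup (range (fun i => (c i * \1_(A i) x)%:E)).

Section level_sup.
Context (R : realType) (T I : Type) (c : I -> R) (A : I -> set T).

Lemma level_sup_ge i x : A i x -> (c i)%:E <= level_sup c A x.
Proof.
move=> Ax; apply: ereal_sup_ubound; exists i => //.
by rewrite indicE mem_set // mulr1.
Qed.

Lemma level_sup_ge0 (i0 : I) x :
  (forall i, 0 <= c i)%R -> 0 <= level_sup c A x.
Proof.
move=> c0; apply: (@le_trans _ _ (c i0 * \1_(A i0) x)%:E).
  by rewrite lee_fin mulr_ge0 // indicE.
by apply: ereal_sup_ubound; exists i0.
Qed.

Lemma level_sup_gt (a : \bar R) x :
  0 <= a -> a < level_sup c A x -> exists2 i, A i x & a < (c i)%:E.
Proof.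
move=> a0 /ereal_sup_gt[_ [i _ <-]]; rewrite indicE.
have [/set_mem Ax|_] := boolP (x \in A i); first by rewrite mulr1; exists i.
by rewrite mulr0 => /(le_lt_trans a0); rewrite ltxx.
Qed.

End level_sup.

Lemma measurable_level_sup (R : realType) (d : measure_display)
    (T : measurableType d) (I : countType) (c : I -> R) (A : I -> set T) :
  (forall i, measurable (A i)) -> measurable_fun setT (level_sup c A).
Proof.
move=> mA; apply/emeasurable_fun_gtP => t.
pose f i x : \bar R := (c i * \1_(A i) x)%:E.
have -> : set_gt (level_sup c A) (cst t%:E) = \bigcup_i set_gt (f i) (cst t%:E).
  apply/seteqP; split=> x.
    by move=> /ereal_sup_gt[_ [i _ <-] ti]; exists i.
  by move=> [i _ ti]; apply: lt_le_trans ti _; apply: ereal_sup_ubound; exists i.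
apply: countable_bigcupT_measurable => // i.
by apply: measurable_set_gt => //; apply/measurable_EFinP; exact: measurable_funM.
Qed.

Theorem proposition2p1 (R : realType) (d : measure_display)
    (T : measurableType d) (mu : {measure set T -> \bar R})
    (mu_wl : weakly_localizable mu)
    (H : set (T -> \bar R))
    (H_meas : forall h, H h -> measurable_fun setT h)
    (H_ge0 : forall h, H h -> forall x, 0 <= h x)
    (H_fin : forall h, H h -> finite_sets mu (set_gt h (cst 0))) :
  exists g : T -> \bar R,
    [/\ measurable_fun setT g,
        forall x, 0 <= g x,
        forall h, H h -> null_sets mu (set_gt h g)
      & forall (F : set T) (u : T -> \bar R),
          measurable F -> measurable_fun setT u -> (forall x, 0 <= u x) ->
          (forall h, H h -> null_sets mu (F `&` set_gt h u)) ->
          null_sets mu (F `&` set_gt g u)].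
Proof.
pose c (q : rat) : R := `|ratr q|%R.
pose EE q := [set set_gt h (cst (c q)%:E) | h in H].
have EE_fin q : EE q `<=` finite_sets mu.
  move=> _ [h Hh <-]; have [m0 fin0] := H_fin h Hh.
  have mh : measurable (set_gt h (cst (c q)%:E)).
    by apply: measurable_set_gt => //; exact: H_meas.
  split=> //; apply: le_lt_trans fin0.
  apply: le_measure; rewrite ?inE // => x; apply: le_lt_trans.
  by rewrite lee_fin normr_ge0.
have [A A_sup] := choice (fun q => mu_wl (EE q) (EE_fin q)).
have mA q : measurable (A q) by have [] := A_sup q.
have mg : measurable_fun setT (level_sup c A) by exact: measurable_level_sup.
have g0 x : 0 <= level_sup c A x.
  by apply: (level_sup_ge0 _ 0%R) => q; exact: normr_ge0.
exists (level_sup c A); split=> //.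
- move=> h Hh.
  apply: (@null_sets_sub_bigcup _ _ _ _ rat
      (fun q => set_gt h (cst (c q)%:E) `\` A q)).
  + by apply: measurable_set_gt => //; exact: H_meas.
  + by move=> q; have [_ EA _] := A_sup q; apply: EA; exists h.
  + move=> x /(rat_dense_ge0_ereal (g0 x))[q /andP[gq qh]].
    exists q => //; split=> // Ax.
    by have := lt_le_trans gq (level_sup_ge c Ax); rewrite ltxx.
- move=> F u mF mu_ u0 Fu.
  have mFu q : measurable (F `&` set_gt (cst (c q)%:E) u).
    by apply: measurableI => //; exact: measurable_set_gt.
  apply: (@null_sets_sub_bigcup _ _ _ _ rat
      (fun q => (F `&` set_gt (cst (c q)%:E) u) `&` A q)).
  + by apply: measurableI => //; exact: measurable_set_gt.
  + move=> q; have [_ _ minA] := A_sup q; apply: minA => // _ [h Hh <-].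
    apply: null_sets_sub (Fu h Hh) _.
      by apply: measurableI => //; apply: measurable_set_gt => //; exact: H_meas.
    by move=> x [[Fx uq] qh]; split=> //; exact: lt_trans uq qh.
  + move=> x [Fx /(level_sup_gt (u0 x))[q Ax uq]].
    by exists q.
Qed.
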